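(* Let $\pi\in\mathbf I_n(3412)$ and $\Psi(\pi)=d_1\cdots d_n$. For each $1\le i\le n-2$, the word $\pi_i\pi_{i+1}\pi_{i+2}$ is order-isomorphic to the pattern determined by $d_id_{i+1}d_{i+2}$ as follows: $HHH\to123$, $HHU\to123$, $HHD\to231$; $HUH\to132$, $HUU\to132$, $HUD\to132$; $HDH\to213$, $HDU\to213$, $HDD\to321$; $UHH\to312$, $UHU\to312$, $UHD\to321$; $UUH\to321$, $UUU\to321$, $UUD\to321$; $UDH\to213$, $UDU\to213$, $UDD\to321$; $DHH\to123$, $DHU\to123$, $DHD\to231$; $DUH\to132$, $DUU\to132$, $DUD\to132$; $DDH\to213$, $DDU\to213$, $DDD\to321$.
   Context: $\mathbf I_n(3412)$ is the set of involutions of $\{1,\dots,n\}$ with no subsequence order-isomorphic to $3412$. For an involution $\pi$, $\Psi(\pi)$ is the Motzkin path $d_1\cdots d_n$ (steps $U=(1,1)$, $D=(1,-1)$, $H=(1,0)$) with $d_i=H$ if $i$ is a fixed point, $d_i=U$ if $i$ is the smaller element of a 2-cycle, $d_i=D$ if $i$ is the larger element of a 2-cycle. *)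

(* Defs.v *)
From mathcomp Require Import all_boot all_fingroup.

Set Implicit Arguments.
Unset Strict Implicit.
Unset Printing Implicit Defensive.

Definition order_iso (u v : seq nat) : Prop :=
  size u = size v /\
  forall j k : nat, j < size u -> k < size u ->
    (nth 0 u j < nth 0 u k) = (nth 0 v j < nth 0 v k).

Definition contains (p w : seq nat) : Prop :=
  exists2 s : seq nat, subseq s w & order_iso s p.

(* {1, ..., n} is represented by 'I_n, with the number i encoded by the ordinal
   of value i.-1; the letters of the one-line word are shifted back to 1..n. *)
Definition oneline (n : nat) (pi : 'S_n) : seq nat :=
  [seq (pi i).+1 | i <- enum 'I_n].

Definition invol_avoiding (n : nat) (p : seq nat) (pi : 'S_n) : Prop :=
  involutive pi /\ ~ contains p (oneline pi).

Inductive step : Type := U | D | H.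

(* For an involution, i < pi i says that i is the smaller element of the
   2-cycle (i, pi i), and pi i < i that it is the larger one. *)
Definition Psi (n : nat) (pi : 'S_n) : seq step :=
  [seq (if pi i == i then H else if i < pi i then U else D) | i <- enum 'I_n].

(* Both accessors are indexed from 1. *)
Definition letter (n : nat) (pi : 'S_n) (i : nat) : nat :=
  nth 0 (oneline pi) i.-1.

Definition Psi_step (n : nat) (pi : 'S_n) (i : nat) : step :=
  nth H (Psi pi) i.-1.

Definition step_pattern (a b c : step) : seq nat :=
  match a, b, c with
  | H, H, H => [:: 1; 2; 3]
  | H, H, U => [:: 1; 2; 3]
  | H, H, D => [:: 2; 3; 1]
  | H, U, H => [:: 1; 3; 2]
  | H, U, U => [:: 1; 3; 2]
  | H, U, D => [:: 1; 3; 2]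
  | H, D, H => [:: 2; 1; 3]
  | H, D, U => [:: 2; 1; 3]
  | H, D, D => [:: 3; 2; 1]
  | U, H, H => [:: 3; 1; 2]
  | U, H, U => [:: 3; 1; 2]
  | U, H, D => [:: 3; 2; 1]
  | U, U, H => [:: 3; 2; 1]
  | U, U, U => [:: 3; 2; 1]
  | U, U, D => [:: 3; 2; 1]
  | U, D, H => [:: 2; 1; 3]
  | U, D, U => [:: 2; 1; 3]
  | U, D, D => [:: 3; 2; 1]
  | D, H, H => [:: 1; 2; 3]
  | D, H, U => [:: 1; 2; 3]
  | D, H, D => [:: 2; 3; 1]
  | D, U, H => [:: 1; 3; 2]
  | D, U, U => [:: 1; 3; 2]
  | D, U, D => [:: 1; 3; 2]
  | D, D, H => [:: 2; 1; 3]
  | D, D, U => [:: 2; 1; 3]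
  | D, D, D => [:: 3; 2; 1]
  end.

(* Main.v *)
Require Import Defs.
From mathcomp Require Import all_boot all_order all_fingroup.
From mathcomp Require Import zify.

Set Implicit Arguments.
Unset Strict Implicit.
Unset Printing Implicit Defensive.

Import Order.TTheory.

(** Draw an involution as a set of arcs, one for each 2-cycle.  Two crossing
    arcs [a < b < pi a < pi b] are an occurrence of 3412 at the positions
    [a, b, pi a, pi b], so the arcs of a 3412-avoiding involution do not cross.
    For such an involution, positions [a < b] form an inversion exactly when
    the arc from [a] reaches [b] or the arc from [b] reaches back to [a].  The
    steps decide this at distance one, and also at distance two: an arc opened
    at [a] passes over [a + 1] exactly when it does not close there, and then
    any arc at [a + 1] is nested inside it, so [a + 1] is not a down step. *)

Section NoncrossingInvolution.

Local Open Scope order_scope.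

Variables (disp : Order.disp_t) (T : orderType disp) (f : T -> T).

Definition noncrossing : Prop :=
  forall a b, ~~ [&& a < b, b < f a & f a < f b].

Hypotheses (fK : involutive f) (f_nc : noncrossing).

Lemma noncrossing_nested (a b : T) : a < b < f a -> a < f b < f a.
Proof.
case/andP=> lt_ab lt_b_fa; apply/andP; split.
- rewrite ltNge le_eqVlt; apply/norP; split.
    by apply: contraTneq lt_b_fa => <-; rewrite fK ltxx.
  by apply: contra (f_nc (f b) a) => ->; rewrite fK lt_ab.
- have := f_nc a b; rewrite lt_ab lt_b_fa -leNgt le_eqVlt.
  by rewrite (inj_eq (inv_inj fK)) gt_eqF.
Qed.

Lemma noncrossing_inversionE (a b : T) :
  a < b -> (f b < f a) = (b <= f a) || (f b <= a).
Proof.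
move=> lt_ab; apply/idP/orP => [lt_fb_fa|[]].
- apply/orP; apply: contraNT (f_nc a (f b)).
  by rewrite negb_or -!ltNge fK lt_fb_fa => /andP[-> ->].
- rewrite le_eqVlt => /predU1P[def_b|lt_b_fa].
    by rewrite def_b fK -def_b.
  suff /andP[] : a < f b < f a by [].
  by apply: noncrossing_nested; rewrite lt_ab.
- rewrite le_eqVlt => /predU1P[def_a|lt_fb_a].
    by rewrite -def_a fK def_a.
  suff /andP[] : f b < f a < f (f b) by [].
  by apply: noncrossing_nested; rewrite fK lt_fb_a.
Qed.

End NoncrossingInvolution.

Section NoncrossingOrdinalInvolution.

Variables (n : nat) (f : 'I_n -> 'I_n).
Hypotheses (fK : involutive f) (f_nc : noncrossing f).
Implicit Types a b c : 'I_n.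

Lemma noncrossing_arc_over_succ a b :
  b = a.+1 :> nat -> (b < f a) = (a < f a) && (b <= f b).
Proof.
move=> ab; apply/idP/andP => [lt_b_fa|[lt_a_fa le_b_fb]].
- have /andP[lt_a_fb _] : (a < f b < f a)%O.
    by apply: noncrossing_nested; rewrite // !ltEord lt_b_fa ab leqnn.
  by split; [apply: ltn_trans lt_b_fa; rewrite ab | rewrite ab].
- rewrite ltn_neqAle {2}ab lt_a_fa andbT.
  by apply: contraTneq le_b_fb => /val_inj->; rewrite fK -ltnNge.
Qed.

Lemma noncrossing_arc_over_pred b c :
  c = b.+1 :> nat -> (f c < b) = (f c < c) && (f b <= b).
Proof.
move=> bc; apply/idP/andP => [lt_fc_b|[lt_fc_c le_fb_b]].
- have /andP[_] : (f c < f b < f (f c))%O.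
    by apply: noncrossing_nested; rewrite // !ltEord fK lt_fc_b bc leqnn.
  by rewrite fK ltEord bc ltnS => ->; split=> //; apply: leqW.
- rewrite ltn_neqAle -[X in _ && X]ltnS -bc lt_fc_c andbT.
  by apply: contraTneq le_fb_b => /val_inj<-; rewrite fK -ltnNge.
Qed.

Lemma noncrossing_inversion_succ a b :
  b = a.+1 :> nat -> (f b < f a) = (a < f a) || (f b < b).
Proof.
move=> ab; have lt_ab : a < b by rewrite ab.
by rewrite [LHS](noncrossing_inversionE fK f_nc lt_ab) !leEord ab ltnS.
Qed.

Lemma noncrossing_inversion_succ2 a b c :
  b = a.+1 :> nat -> c = b.+1 :> nat ->
  (f c < f a) = (a < f a) && (b <= f b) || (f c < c) && (f b <= b).
Proof.
move=> ab bc; have lt_ac : a < c by rewrite bc ab.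
rewrite -noncrossing_arc_over_succ // -noncrossing_arc_over_pred //.
by rewrite [LHS](noncrossing_inversionE fK f_nc lt_ac) !leEord bc ab ltnS.
Qed.

End NoncrossingOrdinalInvolution.

Lemma sorted_subseq (T : eqType) (leT : rel T) (s t : seq T) :
  transitive leT -> irreflexive leT -> sorted leT s -> sorted leT t ->
  {subset s <= t} -> subseq s t.
Proof.
move=> leT_tr leT_irr s_sorted t_sorted sub_st.
rewrite (_ : s = [seq x <- t | x \in s]) ?filter_subseq //.
apply: (irr_sorted_eq leT_tr leT_irr) => // [|x].
  exact: sorted_filter.
by rewrite mem_filter andb_idr // => /sub_st.
Qed.

Lemma contains_oneline (n : nat) (pi : 'S_n) (p : seq nat) (s : seq 'I_n) :
  sorted ltn (map val s) -> order_iso [seq (pi k).+1 | k <- s] p ->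
  contains p (oneline pi).
Proof.
move=> s_sorted s_iso; exists [seq (pi k).+1 | k <- s] => //.
apply/map_subseq/(@sorted_subseq _ (relpre val ltn)).
- by move=> ? ? ?; apply: ltn_trans.
- by move=> ?; apply: ltnn.
- by rewrite -sorted_map.
- by rewrite -sorted_map val_enum_ord iota_ltn_sorted.
- by move=> k _; rewrite mem_enum.
Qed.

Lemma order_iso_inversions (u v : seq nat) :
  uniq u -> uniq v -> size u = size v ->
  (forall j k, j < k -> k < size u ->
     (nth 0 u k < nth 0 u j) = (nth 0 v k < nth 0 v j)) ->
  order_iso u v.
Proof.
have ltn_nth (w : seq nat) j k : uniq w -> j < k -> k < size w ->
    (nth 0 w j < nth 0 w k) = ~~ (nth 0 w k < nth 0 w j).
  move=> w_uniq lt_jk lt_kw.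
  by rewrite -leqNgt [RHS]leq_eqVlt nth_uniq ?ltn_eqF // (ltn_trans lt_jk).
move=> u_uniq v_uniq eq_sz inv; split=> // j k lt_j lt_k.
case: (ltngtP j k) => [lt_jk|lt_kj|->]; last by rewrite !ltnn.
- by rewrite (ltn_nth u) // (ltn_nth v) -?eq_sz // inv.
- by rewrite inv.
Qed.

Lemma avoiding_3412_noncrossing (n : nat) (pi : 'S_n) :
  invol_avoiding [:: 3; 4; 1; 2] pi -> noncrossing pi.
Proof.
move=> [piK avoid] a b; rewrite !ltEord.
apply/and3P => -[lt_ab lt_b_pia lt_pia_pib]; apply: avoid.
apply: (@contains_oneline _ _ _ [:: a; b; pi a; pi b]) => /=.
  by apply/and4P.
split=> //= [[|[|[|[|j]]]]] [|[|[|[|k]]]] //= _ _; rewrite ?piK; lia.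
Qed.

Definition is_up (s : step) : bool := if s is U then true else false.
Definition is_down (s : step) : bool := if s is D then true else false.

Lemma size_step_pattern (s t r : step) : size (step_pattern s t r) = 3.
Proof. by case: s t r => [] [] []. Qed.

Lemma uniq_step_pattern (s t r : step) : uniq (step_pattern s t r).
Proof. by case: s t r => [] [] []. Qed.

Lemma order_iso_step_pattern (x y z : nat) (s t r : step) :
  uniq [:: x; y; z] ->
  (y < x) = is_up s || is_down t ->
  (z < y) = is_up t || is_down r ->
  (z < x) = is_up s && ~~ is_down t || is_down r && ~~ is_up t ->
  order_iso [:: x; y; z] (step_pattern s t r).
Proof.
move=> xyz_uniq inv_xy inv_yz inv_xz; apply: order_iso_inversions => //.
- exact: uniq_step_pattern.
- by rewrite size_step_pattern.
- move=> [|[|j]] [|[|[|k]]] //= _ _; rewrite ?inv_xy ?inv_yz ?inv_xz;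
    by case: s t r {inv_xy inv_yz inv_xz} => [] [] [].
Qed.

Lemma nth_map_enum_ord (T : Type) (x0 : T) (n : nat) (g : 'I_n -> T) k :
  nth x0 [seq g i | i <- enum 'I_n] (k : 'I_n) = g k.
Proof. by rewrite (nth_map k) ?size_enum_ord // nth_ord_enum. Qed.

Section OneLine.

Variables (n : nat) (pi : 'S_n).
Implicit Type k : 'I_n.

Lemma letterE k : letter pi k.+1 = (pi k).+1.
Proof. exact: nth_map_enum_ord. Qed.

Lemma Psi_stepE k :
  Psi_step pi k.+1 = if pi k == k then H else if k < pi k then U else D.
Proof. exact: nth_map_enum_ord. Qed.

Lemma is_up_Psi_step k : is_up (Psi_step pi k.+1) = (k < pi k).
Proof. by rewrite Psi_stepE -val_eqE /=; case: ltngtP. Qed.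

Lemma is_down_Psi_step k : is_down (Psi_step pi k.+1) = (pi k < k).
Proof. by rewrite Psi_stepE -val_eqE /=; case: ltngtP. Qed.

End OneLine.

Theorem theorem4p1 (n : nat) (pi : 'S_n)
    (Hpi : invol_avoiding [:: 3; 4; 1; 2] pi) (i : nat)
    (Hi : 1 <= i <= n - 2) :
  order_iso [:: letter pi i; letter pi i.+1; letter pi i.+2]
            (step_pattern (Psi_step pi i) (Psi_step pi i.+1)
                          (Psi_step pi i.+2)).
Proof.
have piK := Hpi.1; have pi_nc := avoiding_3412_noncrossing Hpi.
case: i Hi => [|x] // Hi.
have [lt_x0 lt_x1 lt_x2] : [/\ x < n, x.+1 < n & x.+2 < n] by split; lia.
pose a := Ordinal lt_x0; pose b := Ordinal lt_x1; pose c := Ordinal lt_x2.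
rewrite (letterE pi a) (letterE pi b) (letterE pi c).
apply: (@order_iso_step_pattern _ _ _ (Psi_step pi a.+1) (Psi_step pi b.+1)
                                      (Psi_step pi c.+1)).
- rewrite /= !inE !eqSS !(inj_eq val_inj) !(inj_eq perm_inj).
  by rewrite -!val_eqE /= !ltn_eqF.
- by rewrite is_up_Psi_step is_down_Psi_step; apply: noncrossing_inversion_succ.
- by rewrite is_up_Psi_step is_down_Psi_step; apply: noncrossing_inversion_succ.
- rewrite !is_up_Psi_step !is_down_Psi_step -!leqNgt.
  exact: noncrossing_inversion_succ2.
Qed.
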